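(* A QF ring is right strongly dual Kasch if and only if its Nakayama permutation is the identity permutation.
   Context: Rings are associative, unital and non-trivial; modules are unital right modules. A ring is quasi-Frobenius (QF) if it is one-sided (left or right) Noetherian and one-sided self-injective (equivalently, two-sided Artinian and two-sided self-injective). A ring $R$ is right strongly dual Kasch if every simple right $R$-module $S$ is a homomorphic image of its injective hull $E(S)$. Nakayama permutation: let $R$ be QF, $\bar R=R/\mathrm{Jac}(R)$, and let $1=e_{11}+\cdots+e_{1n_1}+\cdots+e_{s1}+\cdots+e_{sn_s}$ be a decomposition of $1$ into a sum of orthogonal primitive idempotents such that, with $e_i:=e_{i1}$, one has $e_iR\not\cong e_jR$ for $i\neq j$ and $e_{il}R\cong e_iR$ for all $l$. Put $U_i=e_iR$ and $S_i=\bar e_i\bar R$; then $S_1,\dots,S_s$ is a complete irredundant list of simple right $R$-modules up to isomorphism. The Nakayama permutation of $R$ is the permutation $\pi$ of $\{1,\dots,s\}$ determined by $\mathrm{soc}(U_i)\cong S_{\pi(i)}$ for $1\le i\le s$. *)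

(* Defs.v *)
From HB Require Import structures.
From mathcomp Require Import all_boot all_order all_fingroup all_algebra.
From mathcomp Require Import boolp.

Set Implicit Arguments.
Unset Strict Implicit.
Unset Printing Implicit Defensive.

Import GRing.Theory.
Local Open Scope ring_scope.
Local Open Scope quotient_scope.

(* Right R-modules are rendered as [lmodType R^c], where R^c is the converse
   ring; in the right regular module (R^c)^o one has a *: x = x * a. *)

Section Modules.
Variable R : nzRingType.
Implicit Types M N E : lmodType R.

Definition submod M (A : submodClosed M) : Type := {x : M | x \in A}.

HB.instance Definition _ M (A : submodClosed M) := SubChoice.on (submod A).
HB.instance Definition _ M (A : submodClosed M) :=
  [SubChoice_isSubLmodule of submod A by <:].

(* [submodClosed] does not carry closure under opposite, which [Quotient.quot]
   requires; over a ring it follows from closure under scaling. *)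
Definition submod_zmod M (A : submodClosed M) : {pred M} := fun x => x \in A.

Lemma submod_zmod_closed M (A : submodClosed M) : zmod_closed (submod_zmod A).
Proof.
split=> [|x y xA yA]; rewrite /submod_zmod ?rpred0 //= -scaleN1r.
by rewrite rpredD ?rpredZ.
Qed.
HB.instance Definition _ M (A : submodClosed M) :=
  GRing.isZmodClosed.Build M (submod_zmod A) (@submod_zmod_closed M A).

Definition quotmod M (A : submodClosed M) : Type :=
  Quotient.quot (submod_zmod A).

HB.instance Definition _ M (A : submodClosed M) :=
  ZmodQuotient.on (quotmod A).

Section QuotientModule.
Variables (M : lmodType R) (A : submodClosed M).

Definition quot_scale (a : R) : quotmod A -> quotmod A :=
  fun x => \pi_(quotmod A) (a *: generic_quotient.repr x).

Lemma pi_scale a (x : M) :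
  quot_scale a (\pi_(quotmod A) x) = \pi_(quotmod A) (a *: x).
Proof.
apply/eqP; rewrite /quot_scale -Quotient.idealrBE -scalerBr.
have : generic_quotient.repr (\pi_(quotmod A) x) - x \in submod_zmod A.
  by rewrite Quotient.idealrBE reprK.
exact: rpredZ.
Qed.

Lemma quot_scaleA a b x :
  quot_scale a (quot_scale b x) = quot_scale (a * b) x.
Proof. by rewrite -[x]reprK !pi_scale scalerA !reprK. Qed.

Lemma quot_scale1 : left_id 1 quot_scale.
Proof. by move=> x; rewrite -[x]reprK pi_scale scale1r. Qed.

Lemma quot_scaleDr : right_distributive quot_scale +%R.
Proof.
by move=> a x y; rewrite -[x]reprK -[y]reprK -raddfD !pi_scale scalerDr raddfD.
Qed.

Lemma quot_scaleDl x : {morph quot_scale^~ x : a b / a + b}.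
Proof.
by move=> a b; rewrite -[x]reprK !pi_scale scalerDl raddfD.
Qed.

HB.instance Definition _ := GRing.Zmodule_isLmodule.Build R (quotmod A)
  quot_scaleA quot_scale1 quot_scaleDr quot_scaleDl.

End QuotientModule.

Definition mod_iso M N : Prop := exists f : {linear M -> N}, bijective f.

Definition simple_mod M : Prop :=
  (exists x : M, x != 0) /\
  forall A : submodClosed M, A =i pred1 0 \/ A =i predT.

Definition maximal_submod M (A : submodClosed M) : Prop :=
  ~ A =i predT /\
  forall B : submodClosed M, {subset A <= B} -> B =i A \/ B =i predT.

Definition noetherian_mod M : Prop :=
  forall A : nat -> submodClosed M,
    (forall n, {subset A n <= A n.+1}) ->
    exists k, forall n, (k <= n)%N -> A n =i A k.

Definition injective_mod E : Prop :=
  forall (M N : lmodType R) (i : {linear M -> N}) (f : {linear M -> E}),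
    injective i -> exists g : {linear N -> E}, forall x, g (i x) = f x.

Definition injective_hull M E (i : {linear M -> E}) : Prop :=
  [/\ injective_mod E, injective i &
      forall B : submodClosed E, (exists2 y, y \in B & y != 0) ->
        exists2 x, i x \in B & i x != 0].

(* The sum of the simple submodules, as the least submodule containing them. *)
Definition socle M : {pred M} :=
  fun x => `[< forall B : submodClosed M,
    (forall A : submodClosed M, simple_mod (submod A) -> {subset A <= B}) ->
    x \in B >].

Lemma socle_submod_closed M : submod_closed (@socle M).
Proof.
split=> [|a x y /asboolP xS /asboolP yS]; apply/asboolP=> B hB.
  exact: rpred0.
by rewrite rpredD ?rpredZ ?xS ?yS.
Qed.
HB.instance Definition _ M :=
  GRing.isSubmodClosed.Build R M (@socle M) (@socle_submod_closed M).

Definition radical M : {pred M} :=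
  fun x => `[< forall A : submodClosed M, maximal_submod A -> x \in A >].

Lemma radical_submod_closed M : submod_closed (@radical M).
Proof.
split=> [|a x y /asboolP xS /asboolP yS]; apply/asboolP=> B hB.
  exact: rpred0.
by rewrite rpredD ?rpredZ ?xS ?yS.
Qed.
HB.instance Definition _ M :=
  GRing.isSubmodClosed.Build R M (@radical M) (@radical_submod_closed M).

Definition cyclic_submod M (x : M) : {pred M} :=
  fun y => `[< exists a : R, y = a *: x >].

Lemma cyclic_submod_closed M (x : M) : submod_closed (cyclic_submod x).
Proof.
split=> [|a y z /asboolP[b ->] /asboolP[c ->]]; apply/asboolP.
  by exists 0; rewrite scale0r.
by exists (a * b + c); rewrite scalerDl scalerA.
Qed.
HB.instance Definition _ M (x : M) :=
  GRing.isSubmodClosed.Build R M (cyclic_submod x) (cyclic_submod_closed x).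

End Modules.

Section Rings.
Variable R : nzRingType.

(* The two sides are chosen independently of each other. *)
Definition quasi_frobenius : Prop :=
  (noetherian_mod R^o \/ noetherian_mod (R^c)^o) /\
  (injective_mod R^o \/ injective_mod (R^c)^o).

(* [E] is E(S), which is unique up to isomorphism over S. *)
Definition right_strongly_dual_kasch : Prop :=
  forall S : lmodType R^c, simple_mod S ->
    exists (E : lmodType R^c) (i : {linear S -> E}),
      injective_hull i /\
      exists p : {linear E -> S}, forall y, exists x, p x = y.

Definition primitive_idempotent (e : R) : Prop :=
  [/\ e * e = e, e != 0 &
      forall f g : R, f * f = f -> g * g = g -> f * g = 0 -> g * f = 0 ->
        e = f + g -> f = 0 \/ g = 0].

(* e R as a right R-module. *)
Definition right_principal (e : R) : lmodType R^c :=
  submod (cyclic_submod (e : (R^c)^o)).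

(* R / Jac R as a right R-module; Jac R is the intersection of the maximal
   right ideals of R. *)
Definition Rbar : lmodType R^c := quotmod (@radical R^c (R^c)^o).

Definition bar (x : R) : Rbar := \pi_(quotmod (@radical R^c (R^c)^o)) x.

(* \bar e \bar R: since \bar x \bar r = \bar x . r, it is the submodule of Rbar
   generated by \bar e. *)
Definition right_principal_bar (e : R) : lmodType R^c :=
  submod (cyclic_submod (bar e)).

(* The idempotents e_{i1}, ..., e_{i n_i} are e i 0, ..., e i (n i).-1; the
   values e i l with n i <= l are irrelevant. *)
Definition basic_decomposition (s : nat) (n : 'I_s -> nat)
    (e : 'I_s -> nat -> R) : Prop :=
  [/\ forall i, (0 < n i)%N,
      1 = \sum_(i < s) \sum_(l < n i) e i l,
      forall i l, (l < n i)%N -> primitive_idempotent (e i l),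
      forall i l j k, (l < n i)%N -> (k < n j)%N -> (i, l) != (j, k) ->
        e i l * e j k = 0 &
      (forall i j, i != j ->
         ~ mod_iso (right_principal (e i 0%N)) (right_principal (e j 0%N))) /\
      (forall i l, (l < n i)%N ->
         mod_iso (right_principal (e i l)) (right_principal (e i 0%N)))].

Definition nakayama_permutation (s : nat) (e : 'I_s -> nat -> R)
    (pi : {perm 'I_s}) : Prop :=
  forall i, mod_iso (submod (@socle _ (right_principal (e i 0%N))))
                    (right_principal_bar (e (pi i) 0%N)).

End Rings.

(* Main.v *)
Require Import Defs.
From HB Require Import structures.
From mathcomp Require Import all_boot all_order all_fingroup all_algebra.
From mathcomp Require Import boolp.
From mathcomp Require classical_sets.

Set Implicit Arguments.
Unset Strict Implicit.
Unset Printing Implicit Defensive.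

Import GRing.Theory.
Local Open Scope ring_scope.
Local Open Scope quotient_scope.

(** Suppose first that [R] is right self-injective. A primitive idempotent [e]
    then has a uniform injective principal module [U = eR]
    ([primitive_uniform], [principal_injective]), hence a local corner ring
    [eRe] ([primitive_local]), so the top of [U] is simple and every nonzero
    hom from [U] to the top of [fR] comes from an isomorphism of [eR] and [fR]
    ([hom_to_top_iso]). As [soc U_i] is isomorphic to the simple module
    [S_(pi i)], the injective hull of [S_(pi i)] is [U_i] ([principal_hull]).
    If [pi = 1], a simple module [S] is the top of some [U_i], and it is also
    the socle of [U_i]: thus [E(S) = U_i] maps onto [S]. Conversely, if
    [S_(pi i)] is an image of its hull, which is a quotient of [U_i], then it is
    the top of [U_i], and [pi i = i].

    It remains to see that a left self-injective ring that is Noetherian on one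
    side is right self-injective ([noetherian_right_ext]). Write [l] and [r] for
    left and right annihilators and [J] for the radical. Left self-injectivity
    gives [rl(T) = T] for finitely generated right ideals [T]
    ([annihilator_adjoin]). This forces [J] to be nilpotent in both Noetherian
    cases, and every right ideal to be finitely generated: when [R] is left
    Noetherian, because it is then left Artinian ([left_noetherian_dcc]). By
    nilpotency every [R e_i] has a nonzero socle; it determines [i], so by the
    pigeonhole principle every simple left module embeds in [R]
    ([socle_meets_principal]). Since [R] is left injective, it is a cogenerator,
    that is, [lr(L) = L] for all left ideals [L] ([annihilator_lideal]). With
    both annihilator conditions, a homomorphism from a right ideal to [R] is
    extended one generator at a time ([annihilators_right_ext]), and Baer's
    criterion ([left_ideal_ext_injective]) concludes.

    Right [R]-modules being modules over the converse ring, everything is stated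
    for left modules over a ring [Q], to be used with [Q = R] or [Q = R^c]. *)

(** * Submodules as propositional predicates *)

Section Submodules.
Variable Q : nzRingType.
Implicit Types M N : lmodType Q.

Definition is_submod M (P : M -> Prop) : Prop :=
  P 0 /\ forall a x y, P x -> P y -> P (a *: x + y).

Definition adjoin M (P : M -> Prop) (x : M) : M -> Prop :=
  fun y => exists p a, P p /\ y = p + a *: x.

Section Closure.
Variables (M : lmodType Q) (P : M -> Prop).
Hypothesis subP : is_submod P.

Lemma submod0 : P 0. Proof. by case: subP. Qed.

Lemma submodD x y : P x -> P y -> P (x + y).
Proof. by case: subP => _ PD Px Py; rewrite -[x]scale1r; exact: PD. Qed.

Lemma submodZ a x : P x -> P (a *: x).
Proof. by case: subP => P0 PD Px; rewrite -[_ *: _]addr0; exact: PD. Qed.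

Lemma submodB x y : P x -> P y -> P (x - y).
Proof. by move=> Px Py; rewrite -scaleN1r; apply/submodD/submodZ. Qed.

Lemma submod_sum (I : Type) (r : seq I) (C : pred I) (F : I -> M) :
  (forall i, C i -> P (F i)) -> P (\sum_(i <- r | C i) F i).
Proof. by move=> PF; apply: big_ind; [exact: submod0 | exact: submodD |]. Qed.

Lemma adjoin_submod x : is_submod (adjoin P x).
Proof.
split=> [|a _ _ [p [b [Pp ->]]] [q [c [Pq ->]]]].
  by exists 0, 0; rewrite scale0r addr0; split=> //; exact: submod0.
exists (a *: p + q), (a * b + c); split; first by case: subP => _; apply.
by rewrite scalerDr scalerDl scalerA addrACA.
Qed.

Lemma adjoin_sub x y : P y -> adjoin P x y.
Proof. by move=> Py; exists y, 0; rewrite scale0r addr0. Qed.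

Lemma adjoin_mem x : adjoin P x x.
Proof. by exists 0, 1; rewrite scale1r add0r; split=> //; exact: submod0. Qed.

(** Submodules are handled as plain predicates, whose membership is directly a
    proposition; this lemma passes to the bundled boolean ones. *)
Lemma submodClosed_of : exists A : submodClosed M, forall x, (x \in A) <-> P x.
Proof.
pose p : {pred M} := fun x => `[< P x >].
have clp : submod_closed p.
  by case: subP => P0 PD; split=> [|a x y /asboolP Px /asboolP Py];
    apply/asboolP => //; exact: PD.
pose A : submodClosed M :=
  HB.pack_for (submodClosed M) p (GRing.isSubmodClosed.Build Q M p clp).
by exists A => x; split=> /asboolP.
Qed.

End Closure.

Lemma submodClosedP M (A : submodClosed M) : is_submod (fun x => x \in A).
Proof.
by split=> [|a x y xA yA]; [exact: rpred0 | rewrite rpredD ?rpredZ].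
Qed.

Lemma zero_submod M : is_submod (fun x : M => x = 0).
Proof. by split=> // a x y -> ->; rewrite scaler0 addr0. Qed.

Lemma ker_submod M N (f : {linear M -> N}) : is_submod (fun x => f x = 0).
Proof.
by split=> [|a x y fx fy]; rewrite ?linear0 // linearP fx fy scaler0 addr0.
Qed.

Lemma cyclic_submodP M (x : M) : is_submod (fun y => exists a, y = a *: x).
Proof.
split=> [|a _ _ [b ->] [c ->]]; first by exists 0; rewrite scale0r.
by exists (a * b + c); rewrite scalerDl scalerA.
Qed.

(** Zorn's lemma in the one form needed below: with [X = {1}] it yields maximal
    left ideals, with [X = A \ {0}] relative complements of [A], and with
    [X = 0 x E \ {0}] maximal graphs of partial homomorphisms. *)
Lemma max_avoiding M (X P0 : M -> Prop) :
    is_submod P0 -> (forall x, P0 x -> ~ X x) ->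
  exists P : M -> Prop, [/\ is_submod P, forall x, P0 x -> P x,
    forall x, P x -> ~ X x &
    forall P' : M -> Prop, is_submod P' -> (forall x, P x -> P' x) ->
      (forall x, P' x -> ~ X x) -> forall x, P' x -> P x].
Proof.
move=> subP0 P0X.
pose T := {P : M -> Prop |
  [/\ is_submod P, forall x, P0 x -> P x & forall x, P x -> ~ X x]}.
have t0 : T by exists P0; split.
pose R (s t : T) := `[< forall x, sval s x -> sval t x >].
have [|||P Pmax] := @classical_sets.ZL_preorder T t0 R.
- by move=> t; apply/asboolP.
- by move=> r s t /asboolP rs /asboolP st; apply/asboolP=> x /rs /st.
- move=> A totA; have [[s0 As0]|noA] := pselect (exists s, A s); last first.
    by exists t0 => s As; case: noA; exists s.
  pose U x := exists2 s, A s & sval s x.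
  suff UP : [/\ is_submod U, forall x, P0 x -> U x & forall x, U x -> ~ X x].
    by exists (exist _ U UP) => s As; apply/asboolP=> x sx; exists s.
  split.
  + split; first by exists s0 => //; case: (svalP s0) => /submod0.
    move=> a x y [s As sx] [t At ty].
    have [/asboolP st | /asboolP ts] := totA _ _ As At.
      by exists t => //; case: (svalP t) => -[_ tD] _ _; apply: tD => //; exact: st.
    by exists s => //; case: (svalP s) => -[_ sD] _ _; apply: sD => //; exact: ts.
  + by move=> x P0x; exists s0 => //; case: (svalP s0) => _ /(_ x P0x).
  + by move=> x [s As sx]; case: (svalP s) => _ _; apply.
case: P Pmax => P [subP P0P PX] Pmax; exists P; split=> // P' subP' PP' P'X.
have P'T : [/\ is_submod P', forall x, P0 x -> P' x & forall x, P' x -> ~ X x].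
  by split=> // x /P0P /PP'.
have PleP' : R (exist _ P (And3 subP P0P PX)) (exist _ P' P'T) by apply/asboolP.
by have /asboolP := Pmax _ PleP'.
Qed.

Lemma no_chain_max (T : Type) (lt : T -> T -> Prop) (x0 : T) :
    (forall u : nat -> T, ~ forall n, lt (u n) (u n.+1)) ->
  exists x, forall y, ~ lt x y.
Proof.
move=> nochain; apply: contrapT => nomax.
have nxt x : {y | lt x y}.
  apply/cid; apply: contrapT => no; apply: nomax; exists x => y xy.
  by apply: no; exists y.
by apply: (nochain (fun n => iter n (fun x => sval (nxt x)) x0)) => n /=; exact: svalP.
Qed.

(** The maximum condition that follows from the chain condition by dependent
    choice. *)
Lemma noetherian_max M (F : (M -> Prop) -> Prop) (P0 : M -> Prop) :
    noetherian_mod M -> (forall P, F P -> is_submod P) -> F P0 ->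
  exists2 P, F P & forall P', F P' -> (forall x, P x -> P' x) ->
    forall x, P' x -> P x.
Proof.
move=> noethM Fsub FP0.
pose lt (s t : {P | F P}) :=
  (forall x, sval s x -> sval t x) /\ exists2 x, sval t x & ~ sval s x.
have [u incr|[P FP] Pmax] := @no_chain_max _ lt (exist _ _ FP0).
  have subu n := submodClosed_of (Fsub _ (svalP (u n))).
  have [|k kP] := noethM (fun n => sval (cid (subu n))).
    move=> n x; case: cid => A AP; case: cid => B BP /=.
    by rewrite AP BP; case: (incr n) => + _; apply.
  have [_ [x xk1]] := incr k; apply.
  have := kP k.+1 (leqnSn k) x; case: cid => A AP; case: cid => B BP /= E.
  by apply/BP; rewrite -E; apply/AP.
exists P => // P' FP' PP' x P'x; apply: contrapT => nPx.
by apply: (Pmax (exist _ P' FP')); split=> //; exists x.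
Qed.

End Submodules.

(** * Baer's criterion for the regular module *)

Section Baer.
Variable Q : nzRingType.

(** The condition of Baer's criterion for [Q] as a left module over itself. *)
Definition left_ideal_ext : Prop :=
  forall (L : Q^o -> Prop) (f : Q -> Q), is_submod L ->
    (forall a x y, L x -> L y -> f (a * x + y) = a * f x + f y) ->
  exists y, forall x, L x -> f x = x * y.

Lemma injective_left_ideal_ext : injective_mod Q^o -> left_ideal_ext.
Proof.
move=> injQ L f subL fL; have [A AP] := submodClosed_of subL.
have linf : linear (fun x : submod A => f (val x) : Q^o).
  move=> a x y; rewrite linearP /=.
  by rewrite fL //; apply/AP; exact: valP.
pose g : {linear submod A -> Q^o} :=
  HB.pack (fun x : submod A => f (val x) : Q^o) (GRing.isLinear.Build _ _ _ _ _ linf).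
pose i : {linear submod A -> Q^o} := val.
have [h hP] := injQ _ _ i g val_inj.
exists (h 1) => x Lx; have xA : x \in A by apply/AP.
have /= <- := hP (Sub x xA : submod A).
by rewrite -[X in h X]mulr1 (linearZ_LR h).
Qed.

(** A maximal graph [G] of a partial homomorphism [N -> Q] extending [f] is
    total: given [x] outside its domain, the condition applied to the left ideal
    of the [a] with [a x] in the domain tells where to send [x]. *)
Lemma left_ideal_ext_injective : left_ideal_ext -> injective_mod Q^o.
Proof.
move=> ext M N i f inji.
pose G0 (z : (N * Q^o)%type) := exists x, z = (i x, f x).
pose X (z : (N * Q^o)%type) := z.1 = 0 /\ z.2 <> 0.
have subG0 : is_submod (G0 : (N * Q^o)%type -> Prop).
  split=> [|a _ _ [x ->] [y ->]]; first by exists 0; rewrite !linear0.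
  by exists (a *: x + y); rewrite !linearP.
have [|G [subG G0G GX Gmax]] := max_avoiding (X := X) subG0.
  by move=> _ [x ->] [/= ix0]; apply; rewrite -(linear0 i) in ix0;
    rewrite (inji _ _ ix0) linear0.
have Gfun x y y' : G (x, y) -> G (x, y') -> y = y'.
  move=> Gy Gy'; apply/eqP; rewrite -subr_eq0; apply/eqP; apply: contrapT => ny.
  by apply: (GX _ (submodB subG Gy Gy')); split=> //=; rewrite subrr.
have Gtot x : exists y, G (x, y).
  apply: contrapT => nx.
  pose L (a : Q^o) := exists y, G (a *: x, y).
  have subL : is_submod L.
    split=> [|a b c [y Gy] [z Gz]].
      by exists 0; rewrite scale0r; exact: (submod0 subG).
    exists (a *: y + z); rewrite scalerDl -scalerA.
    by case: subG => _ /(_ a _ _ Gy Gz).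
  pose h a := if pselect (L a) is left La then sval (cid La) else 0.
  have hG a : L a -> G (a *: x, h a).
    by move=> La; rewrite /h; case: pselect => // La'; case: cid.
  have [a b c Lb Lc|z zP] := ext L h subL.
    apply: (Gfun ((a * b + c) *: x)).
      by apply: hG; case: subL => _; apply.
    rewrite scalerDl -scalerA.
    by case: subG => _ /(_ a _ _ (hG _ Lb) (hG _ Lc)).
  apply: nx; exists z; apply: (Gmax (adjoin G (x, z : Q^o))).
  - exact: adjoin_submod.
  - exact: adjoin_sub.
  - move=> _ [[u v] [a [Guv ->]]] [/= uax]; apply.
    have E : u = - a *: x by rewrite scaleNr; apply/eqP; rewrite -addr_eq0 uax.
    rewrite {}E in Guv.
    have La : L (- a) by exists v.
    have -> := Gfun _ _ _ Guv (hG _ La); rewrite zP //.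
    by rewrite mulNr; exact: addNr.
  - exact: adjoin_mem.
pose g x := sval (cid (Gtot x)); have gG x : G (x, g x) by rewrite /g; case: cid.
have ling : linear (g : N -> Q^o).
  move=> a x y; apply: (Gfun (a *: x + y)) => //.
  by case: subG => _ /(_ a _ _ (gG x) (gG y)).
pose gl : {linear N -> Q^o} :=
  HB.pack (g : N -> Q^o) (GRing.isLinear.Build _ _ _ _ _ ling).
exists gl => x /=.
by apply: (Gfun (i x)) => //; apply: G0G; exists x.
Qed.

End Baer.

(** * Maximal left ideals, the radical and local idempotents *)

Section LocalIdempotents.
Variable Q : nzRingType.
Implicit Types (L : Q^o -> Prop) (a b c e x y z : Q).

Local Notation J := (@radical Q Q^o).

Lemma lidealM L a x : is_submod L -> L x -> L (a * x).
Proof. by move=> subL; exact: (submodZ subL). Qed.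

Lemma mulr_preim_submod L b : is_submod L ->
  is_submod ((fun x => L (x * b)) : Q^o -> Prop).
Proof.
move=> subL; split; first by rewrite mul0r; exact: (submod0 subL).
move=> a x y Lx Ly; rewrite mulrDl -mulrA.
by apply: (submodD subL) => //; exact: lidealM.
Qed.

Lemma mulr_img_submod L b : is_submod L ->
  is_submod ((fun y => exists2 x, L x & y = x * b) : Q^o -> Prop).
Proof.
move=> subL; split; first by exists 0; [exact: (submod0 subL) | rewrite mul0r].
move=> a _ _ [x Lx ->] [y Ly ->]; exists (a * x + y).
  by case: subL => _; apply.
by rewrite mulrDl -mulrA.
Qed.

Definition maximal_lideal L : Prop :=
  [/\ is_submod L, ~ L 1 & forall x, ~ L x -> exists c, L (1 - c * x)].

Lemma exists_maximal_lideal L : is_submod L -> ~ L 1 ->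
  exists2 M, maximal_lideal M & forall x, L x -> M x.
Proof.
move=> subL L1.
have [x Lx x1|M [subM LM M1 Mmax]] :=
    max_avoiding (X := fun x : Q^o => x = 1) subL.
  by apply: L1; rewrite -x1.
exists M => //; split=> // [|x Mx]; first by move/M1; apply.
have [Mx1|noMx1] := pselect (adjoin M (x : Q^o) 1); last first.
  case: Mx; apply: (Mmax _ (adjoin_submod subM x) (@adjoin_sub Q Q^o _ x)).
    by move=> y + y1; rewrite y1.
  exact: adjoin_mem.
by case: Mx1 => p [c [Mp ->]]; exists c; rewrite addrK.
Qed.

Lemma radicalP x : reflect (forall L, maximal_lideal L -> L x) (x \in J).
Proof.
apply: (iffP (asboolP _)) => [xJ L [subL L1 Lmax]|xL A [nA maxA]].
  have [A AP] := submodClosed_of subL; apply/AP; apply: xJ; split.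
    by move=> /(_ 1); rewrite inE => A1; apply/L1/AP.
  move=> B AB; have [BA|] := pselect (forall y, y \in B -> y \in A).
    by left=> y; apply/idP/idP; [exact: BA | exact: AB].
  move=> /existsNP[y /not_implyP[yB yA]]; right.
  have [|c /AP/AB cB] := Lmax y; first by move/AP.
  have B1 : (1 : Q^o) \in B.
    by rewrite -[X in X \in B](subrK (c * y)) rpredD //; exact: (rpredZ c).
  by move=> z; rewrite inE -[z]mulr1; exact: (rpredZ z).
have subA := submodClosedP A.
suff maxlA : maximal_lideal (fun y : Q^o => y \in A) by exact: xL _ maxlA.
split=> // [A1|y yA].
  by apply: nA => z; rewrite inE -[z]mulr1; exact: (rpredZ z).
have [B BP] := submodClosed_of (adjoin_submod subA (y : Q^o)).
case: (maxA B) => [z zA|BA|BT]; first by apply/BP/adjoin_sub.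
  by case: yA; rewrite -BA; apply/BP; apply: adjoin_mem.
have [|p [c [pA ->]]] := (BP 1).1; first by rewrite BT.
by exists c; rewrite addrK.
Qed.

Lemma radicalMl a x : x \in J -> a * x \in J.
Proof. exact: (rpredZ a). Qed.

(** Right multiplication by [b] pulls a maximal left ideal back to a maximal
    left ideal or to the whole ring. *)
Lemma radicalMr b x : x \in J -> x * b \in J.
Proof.
move=> /radicalP xJ; apply/radicalP=> L [subL L1 Lmax].
have [Lb|Lb] := pselect (L b); first exact: lidealM.
suff maxLb : maximal_lideal ((fun y => L (y * b)) : Q^o -> Prop).
  exact: xJ _ maxLb.
split.
- exact: mulr_preim_submod.
- by rewrite mul1r.
- move=> y /Lmax[c Lc]; exists (b * c).
  have -> : (1 - b * c * y) * b = b * (1 - c * (y * b)).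
    by rewrite mulrBl mulrBr mul1r mulr1 !mulrA.
  exact: lidealM.
Qed.

(** A maximal left ideal containing [Q (1 - x)] would contain both [x] and
    [1 - x]. The left inverse [u] thus obtained is of the form [1 - y] with [y]
    in the radical, so it is left invertible in turn. *)
Lemma radical_quasiregular x : x \in J ->
  exists v, v * (1 - x) = 1 /\ (1 - x) * v = 1.
Proof.
have linv y : y \in J -> exists u, u * (1 - y) = 1.
  move=> yJ; apply: contrapT => nou.
  have [|M maxM LM] := exists_maximal_lideal (cyclic_submodP (1 - y : Q^o)).
    by move=> [u u1]; apply: nou; exists u.
  have My : M y by exact: (radicalP _ yJ).
  case: maxM => subM M1 _; apply: M1; rewrite -[1](subrK y).
  by apply: (submodD subM) => //; apply: LM; exists 1; rewrite scale1r.
move=> xJ; have [u ux] := linv x xJ.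
have uE : u = 1 - - (u * x).
  by rewrite opprK -ux mulrBr mulr1 subrK.
have [|w wu] := linv (- (u * x)); first by rewrite -mulNr radicalMl.
rewrite -uE in wu; exists u; split=> //.
have : w * (u * (1 - x)) = 1 - x by rewrite mulrA wu mul1r.
by rewrite ux mulr1 => <-.
Qed.

Definition corner_unit e x : Prop := exists c, c * x = e /\ x * c = e.

(** The corner ring [e Q e], whose unit is [e], is local. *)
Definition local_idempotent e : Prop :=
  [/\ e * e = e, e != 0 &
      forall a, corner_unit e (e * a * e) \/ corner_unit e (e - e * a * e)].

Lemma idempotent_notin_radical e : e * e = e -> e != 0 -> e \notin J.
Proof.
move=> ee e0; apply/negP=> /radical_quasiregular[v [_ v1]].
by case/eqP: e0; rewrite -[e]mulr1 -v1 mulrA mulrBr mulr1 ee subrr mul0r.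
Qed.

(** The corner of [e] being local, [J e] is the largest proper submodule of
    [Q e]. *)
Lemma notin_radical_gen e a :
  local_idempotent e -> a * e \notin J -> exists c, c * (a * e) = e.
Proof.
move=> [ee _ eloc] /radicalP/existsNP[L /not_implyP[[subL L1 Lmax] Lae]].
have [c Lc] := Lmax _ Lae.
have [[d [de _]]|[d [de _]]] := eloc (c * a).
  by exists (d * e * c); rewrite -[RHS]de !mulrA.
case: Lae; apply: lidealM => //; rewrite -de; apply: (lidealM _ subL).
have -> : e - e * (c * a) * e = e * (1 - c * (a * e)).
  by rewrite mulrBr mulr1 !mulrA.
exact: lidealM.
Qed.

Lemma primitive_subidempotent e g : primitive_idempotent e ->
  g * g = g -> e * g = g -> g * e = g -> g != 0 -> g = e.
Proof.
move=> [ee _ eprim] gg eg ge g0.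
have [||||| g00|/eqP] := eprim g (e - g); rewrite ?(subr_eq0, mulrBl, mulrBr);
  rewrite ?gg ?ee ?eg ?ge ?subrr ?subr0 //.
- by rewrite addrC subrK.
- by rewrite g00 eqxx in g0.
- by move/eqP.
Qed.

End LocalIdempotents.

(** * Primitive idempotents of a self-injective ring are local *)

Section SelfInjective.
Variable Q : nzRingType.
Hypothesis extQ : left_ideal_ext Q.
Implicit Types (a b c d e x y z : Q).

(** The extension property for a linear map given by its graph, so that partial
    maps need not be made into functions by choice at each use. *)
Lemma right_mul_of_graph (G : Q -> Q -> Prop) :
    G 0 0 ->
    (forall a x y x' y', G x y -> G x' y' -> G (a * x + x') (a * y + y')) ->
    (forall y, G 0 y -> y = 0) ->
  exists c, forall x y, G x y -> y = x * c.
Proof.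
move=> G0 GD Gfun0.
have Gfun x y y' : G x y -> G x y' -> y = y'.
  move=> Gy Gy'; apply/eqP; rewrite eq_sym -subr_eq0; apply/eqP/Gfun0.
  by have := GD (-1) _ _ _ _ Gy Gy'; rewrite !mulN1r !(addrC (- _)) subrr.
pose L (x : Q^o) := exists y, G x y.
pose h x := if pselect (exists y, G x y) is left w then sval (cid w) else 0.
have hG x y : G x y -> h x = y.
  move=> Gxy; rewrite /h; case: pselect => [w|[]]; last by exists y.
  by case: cid => z /= /Gfun; apply.
have [||c cP] := extQ (L := L) (f := h).
- split=> [|a x x' [y Gy] [y' Gy']]; first by exists 0.
  by exists (a * y + y'); exact: GD.
- move=> a x x' [y Gy] [y' Gy'].
  by rewrite (hG _ _ Gy) (hG _ _ Gy'); apply/hG/GD.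
by exists c => x y Gxy; rewrite -(hG _ _ Gxy) cP //; exists y.
Qed.

Lemma right_mul_of_ann (N : Q^o -> Prop) x y :
    is_submod N -> (forall c, N c -> c * x = 0 -> c * y = 0) ->
  exists z, forall c, N c -> c * y = c * (x * z).
Proof.
move=> subN xy.
have [||_ [c [Nc c0 <-]]|z zP] := @right_mul_of_graph
    (fun u v => exists c, [/\ N c, c * x = u & c * y = v]).
- by exists 0; rewrite !mul0r; split=> //; exact: (submod0 subN).
- move=> a _ _ _ _ [c [Nc <- <-]] [c' [Nc' <- <-]]; exists (a * c + c').
  by split; [case: subN => _; apply | rewrite mulrDl mulrA..].
- exact: xy.
by exists z => c Nc; rewrite mulrA; apply: zP; exists c.
Qed.

(** A pair of disjoint submodules of [Q e] is enlarged to a maximal pair [A],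
    [B]. The projection of [A + B] onto [A] is right multiplication by some [g]
    in [e Q e]; maximality of [B] makes [A] essential in [Q e g], maximality of
    [A] then gives [Q e g = A]. So [g] is idempotent, and [g = 0] or [g = e]. *)
Lemma primitive_uniform e x0 y0 : primitive_idempotent e ->
    x0 * e = x0 -> y0 * e = y0 -> x0 != 0 -> y0 != 0 ->
  exists c d, c * x0 = d * y0 /\ c * x0 != 0.
Proof.
move=> prime x0e y0e x00 y00; apply: contrapT => disj.
have [ee e0 _] := prime.
pose A0 (z : Q^o) := exists c, z = c *: (x0 : Q^o).
pose B0 (z : Q^o) := exists c, z = c *: (y0 : Q^o).
(* Avoiding the vectors that [e] does not fix keeps [A] and [B] inside [Q e]. *)
pose XA (z : Q^o) := A0 z /\ z <> 0 \/ z * e <> z.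
have [_ [d ->] [[[c E] n0]|]|B [subB B0B BX Bmax]] :=
    max_avoiding (X := XA) (cyclic_submodP (y0 : Q^o)).
- by apply: disj; exists c, d; split; [|rewrite -[c * x0]E; apply/eqP].
- by apply; rewrite -[_ *: _]/(d * y0) -mulrA y0e.
have Be z : B z -> z * e = z.
  by move=> /BX nX; apply: contrapT => ne; apply: nX; right.
pose XB (z : Q^o) := B z /\ z <> 0 \/ z * e <> z.
have [z Az|A [subA A0A AX Amax]] :=
    max_avoiding (X := XB) (cyclic_submodP (x0 : Q^o)).
  case=> [[Bz n0]|]; first by apply: (BX _ Bz); left.
  by case: Az => c ->; apply; rewrite -[_ *: _]/(c * x0) -mulrA x0e.
have Ae z : A z -> z * e = z.
  by move=> /AX nX; apply: contrapT => ne; apply: nX; right.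
have AB z : A z -> B z -> z = 0.
  by move=> /AX nX Bz; apply: contrapT => ne; apply: nX; left.
have [||a [Aa Ba]|g' g'P] :=
    @right_mul_of_graph (fun z a => A a /\ B (z - a)).
- by rewrite subr0; split; [exact: (submod0 subA) | exact: (submod0 subB)].
- move=> c z a z' a' [Aa Ba] [Aa' Ba']; split; first by case: subA => _; apply.
  by rewrite opprD addrACA -mulrBr; case: subB => _; apply.
- by apply: AB => //; rewrite -[a]opprK -[- a]add0r -mulN1r; exact: lidealM.
(* Compressing to the corner of [e] does not change the action on [A + B]. *)
pose g := e * g' * e.
have Ag a : A a -> a * g = a.
  move=> Aa; rewrite /g !mulrA (Ae a) // -(g'P a a) ?Ae // subrr.
  by split=> //; exact: (submod0 subB).
have Bg b : B b -> b * g = 0.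
  move=> Bb; rewrite /g !mulrA (Be b) // -(g'P b 0) ?mul0r // subr0.
  by split=> //; exact: (submod0 subA).
have ess x : x * e = x -> ~ B x -> exists c, A0 (c * x * g) /\ c * x * g <> 0.
  move=> xe nBx.
  have [meet|nomeet] := pselect (exists2 z, adjoin B (x : Q^o) z & XA z).
    case: meet => _ [b [c [Bb ->]]] [[A0z nz]|]; last first.
      by case; rewrite mulrDl (Be b) // -[_ *: _]/(c * x) -mulrA xe.
    exists c; suff <- : b + c *: (x : Q^o) = c * x * g by [].
    by rewrite -[LHS](Ag _ (A0A _ A0z)) mulrDl Bg // add0r.
  case: nBx; apply: (Bmax _ (adjoin_submod subB x) (@adjoin_sub Q Q^o _ x)).
    by move=> z Bxz Xz; apply: nomeet; exists z.
  exact: adjoin_mem.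
have imgA x : x * e = x -> A (x * g).
  move=> xe.
  pose I (y : Q^o) := exists2 z, z * e = z & y = z * g.
  have subI : is_submod I.
    apply: (@mulr_img_submod Q (fun z => z * e = z)); split; first exact: mul0r.
    by move=> c z w ze we; rewrite mulrDl -mulrA ze we.
  apply: (Amax I subI) => [a Aa|_ [z ze ->]|]; last by exists x.
    by exists a; rewrite ?Ag ?Ae.
  case=> [[Bzg nzg]|]; last by case; rewrite /g !mulrA -(mulrA _ e e) ee.
  have [Bz|nBz] := pselect (B z); first by case: nzg; exact: Bg.
  have [c [A0c nc]] := ess z ze nBz.
  by apply: (BX (c * z * g)); [rewrite -mulrA; exact: (lidealM _ subB) | left].
have eg : e * g = g by rewrite /g !mulrA ee.
have ge : g * e = g by rewrite /g -mulrA ee.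
have gg : g * g = g by move: (imgA e ee); rewrite eg; exact: Ag.
have A0x0 : A x0 by apply: A0A; exists 1; rewrite scale1r.
have B0y0 : B y0 by apply: B0B; exists 1; rewrite scale1r.
have gE : g = e.
  apply: primitive_subidempotent => //; apply/eqP=> g0.
  by case/eqP: x00; rewrite -(Ag _ A0x0) g0 mulr0.
by case/eqP: y00; rewrite -y0e -gE Bg.
Qed.

(** Right multiplication by [u] is a monomorphism of [Q e], so injectivity gives
    [b] with [u b = e]; then [b u] is a nonzero idempotent below the primitive
    [e]. *)
Lemma primitive_injective_unit e u : primitive_idempotent e ->
    e * u = u -> u * e = u -> (forall x, x * e = x -> x * u = 0 -> x = 0) ->
  corner_unit e u.
Proof.
move=> prime eu ue inju; have [ee e0 _] := prime.
have [||z zP] := @right_mul_of_ann (fun=> True) u e; first by [].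
  by move=> c _ cu; apply: inju; rewrite -mulrA ?ee // eu.
have zE : e = u * z by move: (zP 1 I); rewrite !mul1r.
pose b := e * z * e.
have ub : u * b = e by rewrite /b !mulrA ue -zE ee.
exists b; split=> //; apply: primitive_subidempotent => //.
- by rewrite mulrA -(mulrA b) ub -mulrA eu.
- by rewrite /b !mulrA ee.
- by rewrite -mulrA ue.
apply: contra_neq e0 => bu.
by rewrite -ee -ub mulrA -(mulrA u) bu mulr0 mul0r.
Qed.

(** If neither [u] nor [e - u] is injective on [Q e], their kernels meet by
    uniformity, which is absurd. *)
Lemma primitive_local e : primitive_idempotent e -> local_idempotent e.
Proof.
move=> prime; have [ee e0 _] := prime; split=> // a.
set u := e * a * e.
have eu : e * u = u by rewrite /u !mulrA ee.
have ue : u * e = u by rewrite /u -mulrA ee.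
have [inju|] := pselect (forall x, x * e = x -> x * u = 0 -> x = 0).
  by left; exact: primitive_injective_unit.
move=> /existsNP[x /not_implyP[xe /not_implyP[xu /eqP x0]]].
right; apply: primitive_injective_unit => //.
- by rewrite mulrBr ee eu.
- by rewrite mulrBl ee ue.
move=> y ye yu; apply/eqP/contraT => y0.
have [c [d [cd /eqP[]]]] := primitive_uniform prime xe ye x0 y0.
have -> : c * x = d * (y * (e - u)) + c * (x * u).
  by rewrite mulrBr ye mulrBr !mulrA -cd subrK.
by rewrite yu xu !mulr0 addr0.
Qed.

End SelfInjective.

(** * Annihilators over a left self-injective ring *)

Section Annihilators.
Variable R : nzRingType.
Hypothesis extR : left_ideal_ext R.
Implicit Types (T : (R^c)^o -> Prop) (L : R^o -> Prop) (a b c j r t u v w x y z : R).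

Local Notation J := (@radical R R^o).

Lemma rscaleE a x : (a : R^c) *: (x : (R^c)^o) = x * a :> R.
Proof. by []. Qed.

Definition lann T : R^o -> Prop := fun a => forall t, T t -> a * t = 0.
Definition rann L : (R^c)^o -> Prop := fun x => forall a, L a -> a * x = 0.

Lemma lann_submod T : is_submod (lann T).
Proof.
split=> [t _|a x y xT yT t Tt]; first exact: mul0r.
by rewrite mulrDl -mulrA xT // yT // mulr0 addr0.
Qed.

Lemma ridealM T t a : is_submod T -> T t -> T (t * a).
Proof. by move=> subT; exact: (@submodZ R^c _ T subT a t). Qed.

Definition annihilator_rideal T : Prop := forall x, rann (lann T) x -> T x.

Lemma annihilator_rideal0 : annihilator_rideal (fun x => x = 0).
Proof. by move=> x /(_ 1); rewrite mul1r; apply=> _ ->; rewrite mulr0. Qed.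

(** If [y] is killed by [l(T + xR)], then [ax |-> ay] is well defined on
    [l(T)x], hence is right multiplication by some [c], and [y - xc] is killed
    by [l(T)]. *)
Lemma annihilator_adjoin T x : annihilator_rideal T ->
  annihilator_rideal (adjoin T (x : (R^c)^o)).
Proof.
move=> annT y yTx.
have [c Tc cx0|z zP] := right_mul_of_ann extR (x := x) (y := y) (lann_submod T).
  apply: yTx => _ [t [a [Tt ->]]].
  by rewrite rscaleE mulrDr Tc // add0r mulrA cx0 mul0r.
exists (y - x * z), z; split; last by rewrite rscaleE subrK.
by apply: annT => c Tc; rewrite mulrBr zP // subrr.
Qed.

Definition annihilator_acc : Prop :=
  forall F : ((R^c)^o -> Prop) -> Prop,
    (forall P, F P -> is_submod P /\ annihilator_rideal P) ->
  forall P0, F P0 ->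
  exists2 P, F P & forall P', F P' -> (forall x, P x -> P' x) ->
    forall x, P' x -> P x.

(** By the ascending chain condition every right ideal is reached from [0] by
    adjoining elements one at a time. *)
Lemma right_ideal_ind (C : ((R^c)^o -> Prop) -> Prop) :
    annihilator_acc ->
    C (fun x => x = 0) ->
    (forall T x, is_submod T -> annihilator_rideal T -> C T ->
       C (adjoin T (x : (R^c)^o))) ->
  forall T, is_submod T -> annihilator_rideal T /\ C T.
Proof.
move=> acc C0 CD T subT.
pose F P := [/\ is_submod P, annihilator_rideal P, C P &
                forall x, P x -> T x].
have [||P [subP annP CP PT] Pmax] := acc F _ (fun x => x = 0).
- by move=> P [].
- split=> //; [exact: zero_submod | exact: annihilator_rideal0 |].
  by move=> _ ->; exact: (submod0 subT).
suff -> : T = P by [].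
apply/predeqP=> x; split=> [Tx|]; last exact: PT.
apply: (Pmax (adjoin P (x : (R^c)^o))); last exact: adjoin_mem.
- split; [exact: adjoin_submod | exact: annihilator_adjoin | exact: CD |].
  move=> _ [p [a [Pp ->]]]; apply: (submodD subT); first exact: PT.
  exact: (submodZ subT).
- exact: (@adjoin_sub R^c _ P x).
Qed.

(** Any right-linear map [f] on [T + xR] is corrected by left multiplications:
    if [f = c] on [T], then [f x - c x] is killed by [r(l(T)x)], so it belongs
    to [l(T)x] when left ideals are annihilators. *)
Lemma annihilators_right_ext :
    annihilator_acc ->
    (forall L, is_submod L -> forall x, (forall y, rann L y -> x * y = 0) ->
       L x) ->
  left_ideal_ext R^c.
Proof.
move=> acc annL T f subT; move: f.
pose C T := forall f : R -> R,
  (forall a x y, T x -> T y -> f (x * a + y) = f x * a + f y) ->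
  exists c, forall x, T x -> f x = c * x.
suff CT : C T by move=> f fT; have [c cP] := CT f fT; exists c.
have [] // := right_ideal_ind (C := C) acc _ _ subT.
- move=> f f0; exists 0 => _ ->; rewrite mulr0.
  have := f0 (-1) 0 0 erefl erefl.
  by rewrite mul0r addr0 mulrN1 addNr.
move=> {subT}T x subT annT CT f fD; have Tsub := @adjoin_sub R^c _ T x.
have Tx := @adjoin_mem R^c _ T subT x.
have [a y z Ty Tz|c cP] := CT f; first by apply: fD; exact: Tsub.
have T0 := submod0 subT.
have f0 : f 0 = 0 by rewrite cP ?mulr0.
have fM a : f (x * a) = f x * a.
  by have := fD a x 0 Tx (Tsub _ T0); rewrite f0 !addr0.
have [|d dT dE] := annL _ (mulr_img_submod x (lann_submod T)) (f x - c * x).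
  move=> r rP; rewrite mulrBl -fM -mulrA cP ?subrr //.
  by apply: annT => a aT; rewrite mulrA; apply: rP; exists a.
have fx : f x = (c + d) * x by rewrite mulrDl -dE addrC subrK.
exists (c + d) => _ [t [a [Tt ->]]]; rewrite rscaleE.
rewrite addrC fD //; last exact: Tsub.
by rewrite fx cP // mulrDr mulrA (mulrDl c d t) (dT t) // addr0.
Qed.

(** * Nilpotency of the radical *)

(** [radann k] is the left annihilator of the [k]-th power of [J], that is, the
    [k]-th term of the right socle series when [R / J] is semisimple. *)
Fixpoint radann k : R -> Prop :=
  if k is k'.+1 then fun x => forall j, j \in J -> radann k' (x * j)
  else fun x => x = 0.

Lemma radann_lideal k : is_submod (radann k : R^o -> Prop).
Proof.
elim: k => [|k IHk] /=; first exact: zero_submod.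
split=> [j _|a x y xk yk j jJ]; first by rewrite mul0r; exact: (submod0 IHk).
by rewrite mulrDl -mulrA; case: IHk => _; apply; [exact: xk | exact: yk].
Qed.

Lemma radannMr k x a : radann k x -> radann k (x * a).
Proof.
case: k => /= [->|k xk j jJ]; first by rewrite mul0r.
by rewrite -mulrA; apply/xk/radicalMl.
Qed.

Lemma radann_rideal k : is_submod (radann k : (R^c)^o -> Prop).
Proof.
split=> [|a x y xk yk]; first exact: (submod0 (radann_lideal k)).
by apply: (submodD (radann_lideal k)) => //; exact: radannMr.
Qed.

Lemma radannS k x : radann k x -> radann k.+1 x.
Proof. by move=> xk j _; exact: radannMr. Qed.

Lemma radannS_rann k x j t :
  j \in J -> rann (radann k) t -> rann (radann k.+1) (j * t).
Proof. by move=> jJ tk a ak; rewrite mulrA; apply/tk/ak. Qed.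

Lemma radann_lann_rann k x : lann (rann (radann k)) x -> radann k x.
Proof.
elim: k x => [|k IHk] x xk /=.
  by rewrite -[x]mulr1; apply: xk => _ ->; rewrite mul0r.
move=> j jJ; apply: IHk => t tk; rewrite -mulrA; apply: xk.
exact: radannS_rann.
Qed.

(** [rann (radann k)] contains the [k]-th power of [J], so [x] kills the product
    of this power with [J]; the recursive definition of [radann] peels off the
    factors [J] from the other side. *)
Lemma radannS_last k x :
  (forall t, rann (radann k) t -> radann 1 (x * t)) -> radann k.+1 x.
Proof.
elim: k x => [|k IHk] x xk.
  by rewrite -[x]mulr1; apply: xk => a ->; rewrite mul0r.
move=> j jJ; apply: IHk => t tk; rewrite -mulrA; apply: xk.
exact: radannS_rann.
Qed.

(** Let [A = l(J^n)] be stationary. If [A] is proper, choose [x] outside [A]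
    with the largest left annihilator. Some [xj] is outside [A] and must have
    the same annihilator as [x], so [xjR = rl(xj) = rl(x) = xR], and [x = xjz]
    gives [x = 0] by quasi-regularity. *)
Lemma noetherian_radical_nilpotent :
  noetherian_mod R^o -> exists n, radann n 1.
Proof.
move=> noethR.
pose FA (P : R^o -> Prop) := exists k, P = radann k.
have [||_ [n ->] nmax] := noetherian_max (F := FA) (P0 := radann 0) noethR.
- by move=> _ [k ->]; exact: radann_lideal.
- by exists 0%N.
have {nmax} nS : forall x, radann n.+1 x -> radann n x.
  by apply: nmax; [exists n.+1 | exact: radannS].
exists n; apply: contrapT => n1.
pose F (P : R^o -> Prop) := exists2 x, ~ radann n x & P = (fun c => c * x = 0).
have [||_ [x nx ->] xmax] := noetherian_max (F := F)
    (P0 := fun c => c * 1 = 0) noethR.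
- move=> _ [x _ ->]; split=> [|a b c bx cx]; first exact: mul0r.
  by rewrite mulrDl -mulrA bx cx mulr0 addr0.
- by exists 1.
have [j [jJ nxj]] : exists j, j \in J /\ ~ radann n (x * j).
  apply: contrapT => noj; apply/nx/nS => j jJ.
  by apply: contrapT => nxj; apply: noj; exists j.
have [||z zP] := right_mul_of_ann extR (N := fun=> True) (x := x * j) (y := x).
- by [].
- move=> c _; apply: (xmax (fun c => c * (x * j) = 0)) => [|b bx].
    by exists (x * j).
  by rewrite mulrA bx mul0r.
have xE : x = x * (j * z) by move: (zP 1 I); rewrite !mul1r -mulrA.
have [v [_ jv]] := radical_quasiregular (radicalMr z jJ).
apply: nx; suff -> : x = 0 by exact: (submod0 (radann_lideal n)).
by rewrite -[x]mulr1 -jv mulrA mulrBr mulr1 -xE subrr mul0r.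
Qed.

Lemma annihilator_acc_noetherian :
  noetherian_mod (R^c)^o -> annihilator_acc.
Proof.
by move=> noethR F Fsub P0 FP0; apply: noetherian_max FP0 => // P /Fsub[].
Qed.

(** Let [A = l(J^n)] be stationary, so that [r(A)] is [J^n] when right ideals
    are annihilators. If [J^n] is nonzero, it has a maximal proper right
    subideal [T'], which contains [J^n J] by Nakayama; an element [x] killing
    [T'] but not [J^n] contradicts [l(J^n) = l(J^(n+1))]. *)
Lemma right_noetherian_radical_nilpotent :
  noetherian_mod (R^c)^o -> exists n, radann n 1.
Proof.
move=> noethR.
have ann T : is_submod T -> annihilator_rideal T.
  move=> subT; have acc := annihilator_acc_noetherian noethR.
  by have [] := right_ideal_ind (C := fun=> True) acc I (fun _ _ _ _ => id) subT.
pose FA (P : (R^c)^o -> Prop) := exists k, P = radann k.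
have [||_ [n ->] nmax] := noetherian_max (F := FA) (P0 := radann 0) noethR.
- by move=> _ [k ->]; exact: radann_rideal.
- by exists 0%N.
have {nmax} nS : forall x, radann n.+1 x -> radann n x.
  by apply: nmax; [exists n.+1 | exact: radannS].
exists n; apply: contrapT => n1.
pose T := rann (radann n).
have subT : is_submod T.
  split=> [a _|a x y Tx Ty c cn]; first exact: mulr0.
  by rewrite mulrDr rscaleE mulrA Tx // mul0r Ty // addr0.
have [t Tt t0] : exists2 t, T t & t <> 0.
  apply: contrapT => noT; apply/n1/radann_lann_rann => t Tt; rewrite mul1r.
  by apply: contrapT => t0; apply: noT; exists t.
pose F (P : (R^c)^o -> Prop) :=
  [/\ is_submod P, forall x, P x -> T x & exists2 x, T x & ~ P x].
have [||T' [subT' T'T [t1 Tt1 T't1]] T'max] :=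
    noetherian_max (F := F) (P0 := fun x => x = 0) noethR.
- by move=> P [].
- split; [exact: zero_submod | by move=> _ ->; exact: (submod0 subT) |].
  by exists t.
have [x xT' xt1] : exists2 x, lann T' x & x * t1 <> 0.
  apply: contrapT => nox; apply/T't1/(ann _ subT') => x xT'.
  by apply: contrapT => xt1; apply: nox; exists x.
have TJ u j : T u -> j \in J -> T' (u * j).
  move=> Tu jJ; apply: contrapT => nuj; pose w := u * j.
  have subT'' := @adjoin_submod R^c _ T' subT' w.
  have [[p [a [T'p uE]]]|nu] := pselect (adjoin T' (w : (R^c)^o) u).
    have {}uE : u * (1 - j * a) = p.
      have {}uE : u = p + w * a :> R by exact: uE.
      by rewrite mulrBr mulr1 mulrA -/w {1}uE addrK.
    have [v [_ jv]] := radical_quasiregular (@radicalMr R a j jJ).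
    apply/nuj/(ridealM _ subT'); rewrite -[u]mulr1 -jv mulrA uE.
    exact: (ridealM _ subT').
  apply/nuj/(T'max _ _ (@adjoin_sub R^c _ T' w)); last exact: adjoin_mem.
  split=> //; last by exists u.
  move=> _ [p [a [T'p ->]]]; apply: (submodD subT); first exact: T'T.
  by apply: (submodZ subT); exact: (ridealM _ subT).
apply: xt1; apply: Tt1; apply/nS/radannS_last => u Tu j jJ /=.
by rewrite -mulrA; apply/xT'/TJ.
Qed.

(** * Chain conditions and the left socle *)

(** A set of idempotents contained in no proper left ideal, such as the terms
    of a decomposition of [1]. *)
Variable E : R -> Prop.
Hypothesis Eloc : forall e, E e -> local_idempotent e.
Hypothesis Ecover : forall L, is_submod L -> (forall e, E e -> L e) -> L 1.

Lemma cover_mulr L x : is_submod L -> ~ L x -> exists2 e, E e & ~ L (e * x).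
Proof.
move=> subL nLx; apply: contrapT => noe; apply: nLx; rewrite -[x]mul1r.
apply: (Ecover (mulr_preim_submod x subL)) => e Ee.
by apply: contrapT => nL; apply: noe; exists e.
Qed.

(** Modulo [L], a vector [e x] killed by [J] spans a simple module. *)
Lemma local_absorb L e a x : E e -> is_submod L ->
    (forall j, j \in J -> L (j * x)) -> ~ L (a * (e * x)) ->
  exists c, c * (a * (e * x)) = e * x.
Proof.
move=> Ee subL JxL nL.
have [|c cE] := notin_radical_gen (Eloc Ee) (a := a).
  by apply/negP=> aeJ; apply: nL; rewrite mulrA; exact: JxL.
by exists c; rewrite -[in RHS]cE !mulrA.
Qed.

Hypothesis nilR : exists n, radann n 1.

(** The socle of [R / L] is essential: multiplying [x] by elements of [J] ends
    in [L] by nilpotency, and one stops at the last step outside [L]. *)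
Lemma exists_socle_above L x : is_submod L -> ~ L x ->
  exists c, ~ L (c * x) /\ forall j, j \in J -> L (j * (c * x)).
Proof.
move=> subL nLx; apply: contrapT => nosoc.
have [n n1] := nilR.
suff [c nLc /(_ 1 n1)] : exists2 c, ~ L (c * x) & rann (radann n) (c * x).
  by rewrite mul1r => cx0; apply: nLc; rewrite cx0; exact: (submod0 subL).
elim: n {n1} => [|n [c nLc cn]].
  by exists 1; rewrite mul1r // => a ->; rewrite mul0r.
apply: contrapT => noc; apply: nosoc; exists c; split=> // j jJ.
apply: contrapT => nLj; apply: noc; exists (j * c); first by rewrite -mulrA.
by rewrite -mulrA; exact: radannS_rann.
Qed.

Definition dcc_above L : Prop :=
  forall F : (R^o -> Prop) -> Prop,
    (forall P, F P -> is_submod P /\ forall x, L x -> P x) ->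
  forall P0, F P0 ->
  exists2 P, F P & forall P', F P' -> (forall x, P' x -> P x) ->
    forall x, P x -> P' x.

(** Noetherian induction: if the descending chain condition holds above every
    larger left ideal, it holds above [L + Rx], where [x] spans a simple
    submodule of [R / L]. A minimal member above [L] is then found by minimizing
    its sum with [Rx], and preferring members not containing [x]. *)
Lemma left_noetherian_dcc : noetherian_mod R^o -> dcc_above (fun x => x = 0).
Proof.
move=> noethR; apply: contrapT => ndcc.
have [||L [subL nL] Lmax] := noetherian_max (P0 := fun x : R^o => x = 0)
    (F := fun L => is_submod L /\ ~ dcc_above L) noethR.
- by move=> P [].
- by split=> //; exact: zero_submod.
apply: nL => F Fsub P0 FP0.
have [L1|nL1] := pselect (L (1 : R)).
  exists P0 => // P' FP' _ x _; have [subP' LP'] := Fsub _ FP'.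
  by rewrite -[x : R]mulr1; apply: (lidealM _ subP'); exact: LP'.
have [c [nLc cL]] := exists_socle_above subL nL1.
have [e Ee nLec] := cover_mulr subL nLc.
set x := e * (c * 1) in nLec.
have xsimple r : ~ L (r * x) -> exists d, d * (r * x) = x.
  exact: local_absorb.
have dccx : dcc_above (adjoin L (x : R^o)).
  apply: contrapT => ndccx; apply: nLec.
  apply: (Lmax (adjoin L (x : R^o))); last exact: adjoin_mem.
    by split=> //; exact: adjoin_submod.
  exact: adjoin_sub.
pose F' P := exists2 K, F K & P = adjoin K (x : R^o).
have [|| _ [K0 FK0 ->] K0min] := dccx F' _ (adjoin P0 (x : R^o)).
- move=> _ [K FK ->]; have [subK LK] := Fsub _ FK; split.
    exact: adjoin_submod.
  by move=> _ [l [a [Ll ->]]]; exists l, a; split=> //; exact: LK.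
- by exists P0.
have min K : F K -> (forall y, K y -> adjoin K0 (x : R^o) y) ->
    forall y, adjoin K0 (x : R^o) y -> adjoin K (x : R^o) y.
  move=> FK KK0; apply: K0min; first by exists K.
  move=> _ [k [a [Kk ->]]]; have subK0x := adjoin_submod (Fsub _ FK0).1 (x : R^o).
  apply: (submodD subK0x); first exact: KK0.
  by apply: (submodZ subK0x); apply: adjoin_mem; case: (Fsub _ FK0).
have [[K1 [FK1 nK1x K10]]|noK1] := pselect (exists K,
    [/\ F K, ~ K x & forall y, K y -> adjoin K0 (x : R^o) y]).
  exists K1 => // K FK KK1 y K1y; have [subK1 LK1] := Fsub _ FK1.
  have [k [a [Kk yE]]] := min K FK (fun z Kz => K10 z (KK1 z Kz)) y (K10 y K1y).
  rewrite yE; have [subK LK] := Fsub _ FK; apply: (submodD subK) => //.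
  apply: LK; apply: contrapT => nLax; apply: nK1x.
  have [d <-] := xsimple a nLax; apply: (lidealM _ subK1).
  have -> : a * x = y - k by rewrite yE addrC addKr.
  by apply: (submodB subK1) => //; exact: KK1.
exists K0 => // K FK KK0 y K0y; have [subK _] := Fsub _ FK.
have KK0x z : K z -> adjoin K0 (x : R^o) z by move=> /KK0; exact: adjoin_sub.
have Kx : K x by apply: contrapT => nKx; apply: noK1; exists K.
have [k [a [Kk ->]]] := min K FK KK0x y (@adjoin_sub R R^o K0 x y K0y).
by apply: (submodD subK) => //; exact: (submodZ subK).
Qed.

(** [T |-> l(T)] is injective and order-reversing on right ideals that are
    annihilators. *)
Lemma dcc_annihilator_acc : dcc_above (fun x => x = 0) -> annihilator_acc.
Proof.
move=> dcc F Fsub P0 FP0.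
pose F' L := exists2 P, F P & L = lann P.
have [||_ [P FP ->] Pmin] := dcc F' _ (lann P0).
- move=> _ [P FP ->]; split; first exact: lann_submod.
  by move=> _ -> t _; rewrite mul0r.
- by exists P0.
exists P => // P' FP' PP' x P'x; have [_ annP] := Fsub _ FP; apply: annP => a aP.
suff: lann P' a by apply.
apply: (Pmin (lann P')) => //; first by exists P'.
by move=> b bP' t /PP'; exact: bP'.
Qed.

(** A maximal left ideal [M] misses some [e], and [R / M] is isomorphic to
    [R z] for any nonzero [z] in the left socle with [e z = z]. *)
Lemma annihilator_lideal :
    (forall e, E e ->
      exists z, [/\ z <> 0, e * z = z & forall j, j \in J -> j * z = 0]) ->
  forall L, is_submod L -> forall x, (forall y, rann L y -> x * y = 0) -> L x.
Proof.
move=> socE L subL x xL; apply: contrapT => nLx.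
have [|M maxM AM] := exists_maximal_lideal (mulr_preim_submod x subL).
  by rewrite mul1r.
have [subM M1 Mmax] := maxM.
have [e Ee] := cover_mulr subM M1; rewrite mulr1 => nMe.
have [z [z0 ez Jz]] := socE e Ee.
have Mz a : M (a * e) -> a * z = 0.
  move=> Mae; rewrite -ez mulrA.
  have [/Jz//|/(notin_radical_gen (Eloc Ee))[d dE]] := boolP (a * e \in J).
  by case: nMe; rewrite -dE; exact: lidealM.
have [c Mc] := Mmax _ nMe.
have ecz : e * (c * z) = z.
  apply/eqP; rewrite -subr_eq0 mulrA -[X in _ - X]mul1r -mulrBl -oppr_eq0.
  rewrite -mulNr opprB; apply/eqP/Mz; rewrite mulrBl mul1r -mulrA.
  have <- : e * (1 - c * e) = e - e * (c * e) by rewrite mulrBr mulr1.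
  exact: lidealM.
have Mcz m : M m -> m * (c * z) = 0.
  move=> Mm; rewrite mulrA; apply: Mz.
  have -> : m * c * e = m - m * (1 - c * e).
    by rewrite mulrBr mulr1 mulrA opprB addrC subrK.
  by apply: (submodB subM) => //; exact: lidealM.
have [|||w wP] := right_mul_of_graph extR
    (G := fun u v => exists r, L (u - r * x) /\ v = r * (c * z)).
- by exists 0; rewrite !mul0r subr0; split=> //; exact: (submod0 subL).
- move=> a u _ u' _ [r [Lr ->]] [r' [Lr' ->]].
  exists (a * r + r'); split; last by rewrite mulrDl mulrA.
  by rewrite mulrDl opprD addrACA -mulrA -mulrBr; case: subL => _; apply.
- move=> _ [r [Lr ->]]; apply/Mcz/AM.
  have -> : r * x = -1 * (0 - r * x) by rewrite sub0r mulN1r opprK.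
  exact: (lidealM _ subL).
apply: z0; rewrite -ecz.
have -> : c * z = x * w.
  by apply: wP; exists 1; rewrite !mul1r subrr; split=> //; exact: (submod0 subL).
rewrite xL ?mulr0 // => a La; rewrite -(wP a 0) //.
by exists 0; rewrite !mul0r subr0.
Qed.

End Annihilators.

(** * A self-injective one-sided Noetherian ring is self-injective on both sides *)

(** For idempotents [e] and [f], the modules [Q e] and [Q f] are isomorphic,
    and equivalently so are [e Q] and [f Q]. *)
Definition idempotent_iso (Q : nzRingType) (e f : Q) : Prop :=
  exists a b, a * b = e /\ b * a = f.

Section Symmetry.
Variable R : nzRingType.
Hypothesis extR : left_ideal_ext R.
Variables (s : nat) (n : 'I_s -> nat) (e : 'I_s -> nat -> R).
Hypothesis sum_e : 1 = \sum_(i < s) \sum_(l < n i) e i l.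
Hypothesis n_gt0 : forall i, (0 < n i)%N.
Hypothesis prim_e : forall i l, (l < n i)%N -> primitive_idempotent (e i l).
Hypothesis iso_e : forall i l, (l < n i)%N -> idempotent_iso (e i l) (e i 0%N).
Hypothesis basic_e : forall i j, idempotent_iso (e i 0%N) (e j 0%N) -> i = j.

Local Notation J := (@radical R R^o).
Let E (f : R) := exists i l, (l < n i)%N /\ f = e i l.

Let E_local f : E f -> local_idempotent f.
Proof. by move=> [i [l [il ->]]]; apply/(primitive_local extR)/prim_e. Qed.

Let E_cover (L : R^o -> Prop) : is_submod L -> (forall f, E f -> L f) -> L 1.
Proof.
move=> subL EL; rewrite sum_e; apply: (submod_sum subL) => i _.
by apply: (submod_sum subL) => l _; apply: EL; exists i, l.
Qed.

(** [R z] and [R w] are isomorphic simple submodules of [R e_i] and [R e_j]. By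
    injectivity the isomorphisms extend to maps between [R e_i] and [R e_j],
    whose composite fixes [z], hence is invertible by locality. *)
Lemma socle_determines_principal i j k (z w : R) :
    z <> 0 -> w <> 0 -> e k 0%N * z = z -> e k 0%N * w = w ->
    z * e i 0%N = z -> w * e j 0%N = w ->
    (forall t, t \in J -> t * z = 0) -> (forall t, t \in J -> t * w = 0) ->
  i = j.
Proof.
move=> z0 w0 kz kw zi wj Jz Jw.
have lock := E_local (ex_intro _ k (ex_intro _ 0%N (conj (n_gt0 k) erefl))).
have loci := E_local (ex_intro _ i (ex_intro _ 0%N (conj (n_gt0 i) erefl))).
have [ii _ iloc] := loci; have [jj _ _] := prim_e (n_gt0 j).
have annih u v c : u <> 0 -> e k 0%N * u = u -> e k 0%N * v = v ->
    (forall t, t \in J -> t * v = 0) -> c * u = 0 -> c * v = 0.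
  move=> u0 ku kv Jv cu; rewrite -kv mulrA.
  have [/Jv//|/(notin_radical_gen lock)[d dE]] := boolP (c * e k 0%N \in J).
  by case: u0; rewrite -ku -dE -!mulrA ku cu mulr0.
have [||y yP] := right_mul_of_ann extR (N := fun=> True) (x := z) (y := w).
- by [].
- by move=> c _; exact: annih.
have [||y' yP'] := right_mul_of_ann extR (N := fun=> True) (x := w) (y := z).
- by [].
- by move=> c _; exact: annih.
have wE : w = z * y by move: (yP 1 I); rewrite !mul1r.
have zE : z = w * y' by move: (yP' 1 I); rewrite !mul1r.
pose a := e i 0%N * y * e j 0%N; pose b := e j 0%N * y' * e i 0%N.
have za : z * a = w by rewrite /a !mulrA zi -wE wj.
have wb : w * b = z by rewrite /b !mulrA wj -zE zi.
have ia : e i 0%N * a = a by rewrite /a !mulrA ii.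
have aj : a * e j 0%N = a by rewrite /a -mulrA jj.
have jb : e j 0%N * b = b by rewrite /b !mulrA jj.
have bi : b * e i 0%N = b by rewrite /b -mulrA ii.
clearbody a b.
have abE : e i 0%N * (a * b) * e i 0%N = a * b by rewrite mulrA ia -mulrA bi.
case: (iloc (a * b)); rewrite abE => -[c [_ cE]]; last first.
  case: z0; rewrite -zi -cE mulrA mulrBr mulrA za wb zi.
  by rewrite subrr mul0r.
apply: basic_e; exists a, (b * c * e i 0%N).
have abc : a * (b * c * e i 0%N) = e i 0%N by rewrite !mulrA cE ii.
split=> //; apply: primitive_subidempotent.
- exact: prim_e.
- by rewrite mulrA -(mulrA _ a) abc -(mulrA (b * c)) ii.
- by rewrite !mulrA jb.
- by rewrite -mulrA aj.
apply/eqP=> ba0; apply: z0.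
have <- : z * (a * (b * c * e i 0%N) * (a * (b * c * e i 0%N))) = z.
  by rewrite abc ii zi.
by rewrite -(mulrA a) (mulrA (b * c * _) a) ba0 mul0r !mulr0.
Qed.

Hypothesis nilR : exists n, radann n (1 : R).

(** The socle of [R e_i] determines [i]; as there are as many [e_i] as
    isomorphism classes of simple left modules, every simple left module occurs
    in such a socle. *)
Lemma socle_meets_principal f : E f ->
  exists z, [/\ z <> 0, f * z = z & forall t, t \in J -> t * z = 0].
Proof.
have socP i : {k : 'I_s | exists z, [/\ z <> 0, e k 0%N * z = z,
    z * e i 0%N = z & forall t, t \in J -> t * z = 0]}.
  apply: cid; have [ii /eqP i0 _] := prim_e (n_gt0 i).
  have [c [nz Jz]] := exists_socle_above nilR (@zero_submod R R^o) i0.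
  have [_ [k [l [kl ->]]] nz'] := cover_mulr E_cover (@zero_submod R R^o) nz.
  have [a [b [ab ba]]] := iso_e kl; have [kk _ _] := prim_e kl.
  exists k, (b * (e k l * (c * e i 0%N))); split.
  - by move=> z0; apply: nz'; rewrite -kk -{1}ab -!mulrA z0 mulr0.
  - by rewrite -ba -!mulrA (mulrA a) ab !mulrA -(mulrA b) kk.
  - by rewrite -!mulrA ii.
  - move=> t tJ; rewrite (mulrA t) (mulrA (t * b)); apply: Jz.
    by rewrite -mulrA; exact: radicalMr.
pose sigma i := sval (socP i).
have sigma_inj : injective sigma.
  move=> i j eqk; have [z [z0 kz zi Jz]] := svalP (socP i).
  have [w [w0 kw wj Jw]] := svalP (socP j).
  rewrite -/(sigma i) in kz; rewrite -/(sigma j) -eqk in kw.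
  exact: (socle_determines_principal z0 w0 kz kw).
move=> [k [l [kl ->]]]; have [tau _ tauK] := injF_bij sigma_inj.
have [z [z0 kz _ Jz]] := svalP (socP (tau k)).
rewrite -/(sigma _) tauK in kz.
have [a [b [ab ba]]] := iso_e kl; exists (a * z); split.
- by move=> az0; apply: z0; rewrite -kz -ba -mulrA az0 mulr0.
- by rewrite -ab mulrA -(mulrA a) ba -mulrA kz.
- by move=> t tJ; rewrite mulrA; apply/Jz/radicalMr.
Qed.

Lemma nilpotent_right_ext : annihilator_acc R -> left_ideal_ext R^c.
Proof.
move=> acc; apply: (annihilators_right_ext extR acc).
by apply: (annihilator_lideal extR E_local E_cover); exact: socle_meets_principal.
Qed.

End Symmetry.

(** In both Noetherian cases the radical is nilpotent and the right ideals that
    are annihilators satisfy the ascending chain condition. *)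
Lemma noetherian_right_ext (R : nzRingType) (s : nat) (n : 'I_s -> nat)
    (e : 'I_s -> nat -> R) :
    left_ideal_ext R -> noetherian_mod R^o \/ noetherian_mod (R^c)^o ->
    1 = \sum_(i < s) \sum_(l < n i) e i l ->
    (forall i, (0 < n i)%N) ->
    (forall i l, (l < n i)%N -> primitive_idempotent (e i l)) ->
    (forall i l, (l < n i)%N -> idempotent_iso (e i l) (e i 0%N)) ->
    (forall i j, idempotent_iso (e i 0%N) (e j 0%N) -> i = j) ->
  left_ideal_ext R^c.
Proof.
move=> extR noethR sum_e n_gt0 prim_e iso_e basic_e.
have [nilR acc] : (exists n, radann n (1 : R)) /\ annihilator_acc R.
  case: noethR => noethR; last first.
    split; first exact: right_noetherian_radical_nilpotent.
    exact: annihilator_acc_noetherian.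
  have nilR := noetherian_radical_nilpotent extR noethR; split=> //.
  apply: dcc_annihilator_acc.
  pose E (f : R) := exists i l, (l < n i)%N /\ f = e i l.
  apply: (left_noetherian_dcc (E := E)) => // [_ [i [l [il ->]]]|L subL EL].
    exact/(primitive_local extR)/prim_e.
  rewrite sum_e; apply: (submod_sum subL) => i _.
  by apply: (submod_sum subL) => l _; apply: EL; exists i, l.
exact: (nilpotent_right_ext extR sum_e n_gt0 prim_e iso_e basic_e nilR acc).
Qed.

(** * Principal modules and their tops *)

Section Modules.
Variable Q : nzRingType.
Implicit Types (M N S : lmodType Q) (a b c e f : Q).

Local Notation J := (@radical Q Q^o).

Lemma mod_iso_sym M N : mod_iso M N -> mod_iso N M.
Proof.
move=> [f bijf]; have [g fK gK] := bijf.
have ling : linear g by move=> a x y; apply: (can_inj fK); rewrite linearP !gK.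
pose gl : {linear N -> M} := HB.pack g (GRing.isLinear.Build _ _ _ _ _ ling).
by exists gl; exists f.
Qed.

Lemma mod_iso_trans M N S : mod_iso M N -> mod_iso N S -> mod_iso M S.
Proof. by move=> [f bijf] [g bijg]; exists (g \o f : {linear M -> S}); exact: bij_comp. Qed.

Lemma mod_iso_same_kernel M N S (p : {linear M -> N}) (q : {linear M -> S}) :
    (forall y, exists x, p x = y) -> (forall y, exists x, q x = y) ->
    (forall x, p x = 0 <-> q x = 0) ->
  mod_iso N S.
Proof.
move=> surjp surjq pq.
have eq_pq x x' : p x = p x' <-> q x = q x'.
  split=> /eqP; rewrite -subr_eq0 -linearB => /eqP/pq;
    by rewrite linearB => /eqP; rewrite subr_eq0 => /eqP.
pose g y := q (sval (cid (surjp y))); pose h z := p (sval (cid (surjq z))).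
have gp x : g (p x) = q x by rewrite /g; case: cid => x' /= /eq_pq.
have hq x : h (q x) = p x by rewrite /h; case: cid => x' /= /eq_pq.
have ling : linear g.
  move=> a y y'; have [x <-] := surjp y; have [x' <-] := surjp y'.
  by rewrite -linearP !gp linearP.
pose gl : {linear N -> S} := HB.pack g (GRing.isLinear.Build _ _ _ _ _ ling).
exists gl; exists h => [y|z].
  by have [x <-] := surjp y; rewrite /= gp hq.
by have [x <-] := surjq z; rewrite /= hq gp.
Qed.

Definition scale_at M (x : M) : Q^o -> M := fun a => a *: x.

Lemma scale_at_linear M (x : M) : linear (scale_at x).
Proof. by move=> a b c; rewrite /scale_at scalerDl -scalerA. Qed.

HB.instance Definition _ M (x : M) :=
  GRing.isLinear.Build Q Q^o M _ (scale_at x) (scale_at_linear x).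

Lemma cyclic_mem M (x : M) : x \in cyclic_submod x.
Proof. by apply/asboolP; exists 1; rewrite scale1r. Qed.

Definition cyclic_gen M (x : M) : submod (cyclic_submod x) :=
  Sub x (cyclic_mem x).

Lemma cyclic_genP M (x : M) (u : submod (cyclic_submod x)) :
  exists a, u = a *: cyclic_gen x.
Proof.
have /asboolP[a ua] := valP u; exists a; apply: val_inj.
by rewrite linearZ.
Qed.

Lemma simple_gen S (x y : S) : simple_mod S -> x != 0 -> exists a, y = a *: x.
Proof.
move=> [_ simpleS] x0; case: (simpleS (cyclic_submod x)) => xS.
  by case/negP: x0; have := xS x; rewrite cyclic_mem => /esym.
by have := xS y => /asboolP.
Qed.

Definition left_principal e : lmodType Q := submod (cyclic_submod (e : Q^o)).

Definition principal_gen e : left_principal e := cyclic_gen (e : Q^o).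

Definition principal_top e : lmodType Q :=
  submod (cyclic_submod (\pi_(quotmod J) e : quotmod J)).

Definition top_gen e : principal_top e := cyclic_gen (\pi_(quotmod J) e).

Lemma val_principal_gen e a : val (a *: principal_gen e) = a * e.
Proof. by []. Qed.

Lemma left_principalP e (u : left_principal e) : e * e = e -> val u * e = val u.
Proof.
by move=> ee; have [a ->] := cyclic_genP u; rewrite val_principal_gen -mulrA ee.
Qed.

Lemma principal_genE e (u : left_principal e) : e * e = e ->
  val u *: principal_gen e = u.
Proof.
by move=> ee; apply: val_inj; rewrite val_principal_gen left_principalP.
Qed.

Lemma principal_genZ e : e * e = e -> e *: principal_gen e = principal_gen e.
Proof. by move=> ee; apply: val_inj; rewrite val_principal_gen ee. Qed.

(** A linear map [Q e -> Q f] is right multiplication by the image of [e]. *)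
Lemma idempotent_iso_mod e f : e * e = e -> f * f = f ->
  idempotent_iso e f <-> mod_iso (left_principal e) (left_principal f).
Proof.
move=> ee ff; split.
  move=> [a [b [ab ba]]].
  pose g : {linear left_principal e -> left_principal f} :=
    scale_at (a *: principal_gen f) \o val.
  pose h : {linear left_principal f -> left_principal e} :=
    scale_at (b *: principal_gen e) \o val.
  have gE u : val (g u) = val u * (a * f) by [].
  have hE u : val (h u) = val u * (b * e) by [].
  exists g; exists h => u; apply: val_inj; rewrite ?(hE, gE) ?(gE, hE) -mulrA.
    by rewrite -{1}ba -!mulrA (mulrA a b) ab (mulrA a b) ab !ee left_principalP.
  by rewrite -{1}ab -!mulrA (mulrA b a) ba (mulrA b a) ba !ff left_principalP.
move=> [g [h gK hK]].
set pe := principal_gen e; set pf := principal_gen f.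
exists (val (g pe)), (val (h pf)).
have gE : val (g pe) *: pf = g pe by exact: principal_genE.
have hE : val (h pf) *: pe = h pf by exact: principal_genE.
have hg : val (h pf) *: g pe = pf by rewrite -linearZ /= hE hK.
split; last by move/(congr1 val): hg; rewrite linearZ.
have : (val (g pe) * val (h pf)) *: pe = pe.
  apply: (can_inj gK); rewrite -scalerA linearZ /=.
  by rewrite (linearZ_LR g) hg gE.
by move/(congr1 val); rewrite val_principal_gen -mulrA left_principalP.
Qed.

Lemma bar_eq0 (x : Q) : \pi_(quotmod J) x = 0 <-> x \in J.
Proof.
have := Quotient.idealrBE (submod_zmod J) (x : Q^o) 0; rewrite subr0.
rewrite -[x \in J]/(x \in submod_zmod J) => ->.
split=> [x0|/eqP->]; last exact: raddf0.
by apply/eqP; rewrite x0 raddf0.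
Qed.

Lemma val_top_gen e a : val (a *: top_gen e) = \pi_(quotmod J) (a * e).
Proof. by rewrite linearZ; exact: pi_scale. Qed.

Lemma top_gen_eq0 e a : a *: top_gen e = 0 <-> a * e \in J.
Proof.
rewrite -bar_eq0 -val_top_gen; split=> [->|a0]; first exact: raddf0.
by apply: val_inj; rewrite a0 raddf0.
Qed.

Lemma principal_top_simple e : local_idempotent e -> simple_mod (principal_top e).
Proof.
move=> loce; have [ee e0 _] := loce; split.
  exists (top_gen e); apply/eqP; rewrite -[top_gen e]scale1r => /top_gen_eq0.
  by rewrite mul1r; exact/negP/idempotent_notin_radical.
move=> A; have [[y yA y0]|noy] := pselect (exists2 y, y \in A & y != 0).
  right=> u; rewrite inE; have [b ->] := cyclic_genP u.
  have [a yE] := cyclic_genP y.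
  have [|c cE] := notin_radical_gen loce (a := a).
    by apply/negP => /top_gen_eq0 aJ; move: y0; rewrite yE aJ eqxx.
  have -> : b *: cyclic_gen (\pi_(quotmod J) e) = (b * c) *: y.
    apply: val_inj; rewrite yE scalerA [LHS]val_top_gen [RHS]val_top_gen.
    by rewrite -!mulrA cE.
  exact: rpredZ.
left=> y; rewrite inE; apply/idP/eqP => [yA|->]; last exact: rpred0.
by apply/eqP/contraT => y0; case: noy; exists y.
Qed.

(** A simple image of [Q e] is its top: the kernel is [J e] by locality. *)
Lemma simple_image_principal e S (p : {linear left_principal e -> S}) :
    local_idempotent e -> simple_mod S -> (forall y, exists x, p x = y) ->
  mod_iso S (principal_top e).
Proof.
move=> loce simpleS surjp; have [ee e0 _] := loce.
set s := p (principal_gen e).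
have pE a : p (a *: principal_gen e) = a *: s by rewrite linearZ.
have es : e *: s = s by rewrite -pE principal_genZ.
have s0 : s != 0.
  have [[y y0] _] := simpleS; have [x xy] := surjp y.
  apply: contra_neq y0 => s0; have [a xE] := cyclic_genP x.
  by rewrite -xy xE [LHS]pE s0 scaler0.
pose q : {linear left_principal e -> principal_top e} :=
  scale_at (top_gen e) \o val.
have qE a : q (a *: principal_gen e) = a *: top_gen e.
  rewrite linearZ; congr (_ *: _); apply: val_inj.
  by rewrite [LHS]val_top_gen /= ee.
apply: (mod_iso_same_kernel (q := q) surjp) => [y|u].
  by have [a ->] := cyclic_genP y; exists (a *: principal_gen e); rewrite qE.
have [a ->] := cyclic_genP u; rewrite -/(principal_gen e) pE qE top_gen_eq0.
split=> [as0|aJ].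
  apply: contrapT => /negP/(notin_radical_gen loce)[c cE].
  by case/eqP: s0; rewrite -es -cE -!scalerA es as0 scaler0.
apply/eqP/contraT => as0; have [c cE] := simple_gen s simpleS as0.
have [v [vE _]] := radical_quasiregular (radicalMl c aJ).
case/eqP: s0; rewrite -[s]scale1r -vE -scalerA scalerBl scale1r -!scalerA es.
by rewrite -cE subrr scaler0.
Qed.

(** The image of [e] is the class of some [x] in [e Q f] outside [J]; then [f]
    is a left multiple of [x], which makes [x] an isomorphism. *)
Lemma hom_to_top_iso e f (p : {linear left_principal e -> principal_top f}) :
    primitive_idempotent e -> local_idempotent f -> p (principal_gen e) <> 0 ->
  idempotent_iso e f.
Proof.
move=> prime locf p0; have [ee _ _] := prime; have [ff f0 _] := locf.
have [a pE] := cyclic_genP (p (principal_gen e)).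
have {}pE : p (principal_gen e) = (e * a) *: top_gen f.
  by rewrite -scalerA -[a *: _]pE -linearZ /= principal_genZ.
pose x := e * a * f.
have [|c cE] := notin_radical_gen locf (a := e * a).
  by apply/negP => /top_gen_eq0 x0; apply: p0; rewrite pE.
rewrite -/x in cE; have ex : e * x = x by rewrite /x !mulrA ee.
have xf : x * f = x by rewrite /x -mulrA ff.
clearbody x; pose d := f * c * e.
have dx : d * x = f by rewrite /d -!mulrA ex cE ff.
exists x, d; split=> //; apply: primitive_subidempotent => //.
- by rewrite mulrA -(mulrA x) dx xf.
- by rewrite mulrA ex.
- by rewrite /d -!mulrA ee.
apply: contra_neq f0 => xd.
by rewrite -ff -dx -mulrA (mulrA x) xd mul0r mulr0.
Qed.

(** * Principal modules of a self-injective ring *)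

(** [Q e] is a retract of [Q]. *)
Lemma principal_injective e : e * e = e -> injective_mod Q^o ->
  injective_mod (left_principal e).
Proof.
move=> ee injQ M N i f inji.
have [g gP] := injQ _ _ i (val \o f : {linear M -> Q^o}) inji.
exists (scale_at (principal_gen e) \o g : {linear N -> left_principal e}) => x.
by rewrite /= gP /= /scale_at principal_genE.
Qed.

(** Any nonzero submodule of the uniform module [Q e] is essential. *)
Lemma principal_hull e S (i : {linear S -> left_principal e}) :
    primitive_idempotent e -> injective_mod Q^o -> simple_mod S ->
    injective i ->
  injective_hull i.
Proof.
move=> prime injQ simpleS inji; have [ee _ _] := prime; split=> //.
  exact: principal_injective.
move=> B [y yB y0]; have [[s s0] _] := simpleS.
have val_neq0 (u : left_principal e) : u != 0 -> val u != 0.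
  by apply: contra_neq => u0; apply: val_inj; rewrite u0 raddf0.
have is0 : i s != 0 by apply: contra_neq s0 => /eqP; rewrite raddf_eq0 // => /eqP.
have ext := injective_left_ideal_ext injQ.
have [c [d [cd cs0]]] := primitive_uniform ext prime
  (left_principalP (i s) ee) (left_principalP y ee) (val_neq0 _ is0)
  (val_neq0 _ y0).
have icE : i (c *: s) = d *: y by apply: val_inj; rewrite !linearZ.
exists (c *: s); first by rewrite icE; exact: rpredZ.
by apply: contra_neq cs0 => ic0; move: (congr1 val ic0); rewrite linearZ linearZ raddf0.
Qed.

End Modules.

Lemma converse_primitive (R : nzRingType) (e : R) :
  primitive_idempotent e -> primitive_idempotent (e : R^c).
Proof.
move=> [ee e0 eprim]; split=> // f g ff gg fg gf efg.
exact: (eprim f g ff gg gf fg efg).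
Qed.

Lemma converse_idempotent_iso (R : nzRingType) (e f : R) :
  idempotent_iso (e : R^c) (f : R^c) <-> idempotent_iso e f.
Proof. by split=> -[a [b [ab ba]]]; exists b, a. Qed.

Theorem proposition2p15 (R : nzRingType) (R_QF : quasi_frobenius R)
    (s : nat) (n : 'I_s -> nat) (e : 'I_s -> nat -> R)
    (e_dec : basic_decomposition n e)
    (pi : {perm 'I_s}) (pi_nak : nakayama_permutation e pi) :
  right_strongly_dual_kasch R <-> pi = 1%g.
Proof.
have [n_gt0 sum_e prim_e _ [basic_e iso_e]] := e_dec.
have primc i l : (l < n i)%N -> primitive_idempotent (e i l : R^c).
  by move=> il; apply/converse_primitive/prim_e.
have idem i l : (l < n i)%N -> (e i l : R^c) * e i l = e i l.
  by move=> /primc[].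
have isoc i l : (l < n i)%N -> idempotent_iso (e i l : R^c) (e i 0%N).
  by move=> il; apply/idempotent_iso_mod; [exact: idem.. | exact: iso_e].
have basicc i j : idempotent_iso (e i 0%N : R^c) (e j 0%N) -> i = j.
  move=> ij; apply/eqP/contraT => /basic_e; case.
  by apply/(@idempotent_iso_mod R^c); [exact: idem.. | ].
have extc : left_ideal_ext R^c.
  case: R_QF => noethR [] injR; last exact: injective_left_ideal_ext.
  apply: (@noetherian_right_ext R s n e) => //.
  - exact: injective_left_ideal_ext.
  - by move=> i l /isoc /converse_idempotent_iso.
  - by move=> i j /converse_idempotent_iso /basicc.
have injc := left_ideal_ext_injective extc.
have locc i : local_idempotent (e i 0%N : R^c).
  exact/(primitive_local extc)/primc.
split=> [dualK|pi1 S simpleS].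
  apply/permP=> i; rewrite perm1; symmetry; apply: basicc.
  have simpleS := principal_top_simple (locc (pi i)).
  have [E [iota [[injE inji essE] [p surjp]]]] := dualK _ simpleS.
  have [k /bij_inj injk] := mod_iso_sym (pi_nak i).
  pose kappa : {linear right_principal_bar (e (pi i) 0%N) ->
      right_principal (e i 0%N)} := val \o k.
  have injkappa : injective kappa by move=> x y /val_inj/injk.
  (* [E] embeds in [U_i] and splits off, so [U_i] maps onto [S_(pi i)]. *)
  have [g gP] := principal_injective (idem _ _ (n_gt0 i)) injc kappa inji.
  have injg : injective g.
    apply/raddf_inj => y gy; apply/eqP/contraT => y0.
    have [B BP] := submodClosed_of (ker_submod g).
    have [|x xB /eqP[]] := essE B; first by exists y => //; apply/BP.
    move/BP: xB; rewrite gP => kx; suff -> : x = 0 by rewrite raddf0.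
    by apply: injkappa; rewrite kx raddf0.
  have [h hP] := injE _ _ g idfun injg.
  apply: (@hom_to_top_iso R^c _ _ (p \o h)); [exact: primc | exact: locc |].
  move=> ph0; have [[x /eqP x0] _] := simpleS; apply: x0.
  have [y <-] := surjp x; rewrite -[y]hP.
  have [a ->] := cyclic_genP (g y).
  by rewrite linearZ linearZ /= [X in _ *: X]ph0 scaler0.
have [[x /eqP x0] _] := simpleS.
have [i [l [il nx]]] : exists i l, (l < n i)%N /\ (e i l : R^c) *: x <> 0.
  apply: contrapT => noil; apply: x0; rewrite -[x]scale1r.
  rewrite [1 : R^c]sum_e; apply: (submod_sum (ker_submod (scale_at x))) => i _.
  apply: (submod_sum (ker_submod (scale_at x))) => l _.
  by apply: contrapT => nx; apply: noil; exists i, l.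
(* [x] is moved to a vector fixed by the representative [e i 0]. *)
have [a [b [ab ba]]] := isoc i l il; have ee := idem _ _ (n_gt0 i).
pose x' := (b * e i l : R^c) *: x.
have ex' : (e i 0%N : R^c) *: x' = x'.
  by rewrite scalerA -ba !mulrA -(mulrA b) ab -mulrA idem.
have nx' : x' != 0.
  apply/eqP => x'0; apply: nx; have := scaler0 S a; rewrite -x'0 scalerA.
  by rewrite mulrA ab idem // => ->; rewrite x'0.
pose p : {linear right_principal (e i 0%N) -> S} := scale_at x' \o val.
have surjp y : exists u, p u = y.
  have [c ->] := simple_gen y simpleS nx'.
  exists (c *: principal_gen (e i 0%N : R^c)).
  by rewrite linearZ; congr (_ *: _); exact: ex'.
have := pi_nak i; rewrite pi1 perm1 => socU.
have [k /bij_inj injk] :=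
  mod_iso_trans (simple_image_principal (locc i) simpleS surjp)
                (mod_iso_sym socU).
exists (right_principal (e i 0%N)), (val \o k); split; last by exists p.
apply: principal_hull => //; first exact: primc.
by move=> y z /val_inj/injk.
Qed.
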